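(* There exist standard probability spaces $(X,\mu)$ and $(Y,\nu)$, an ergodic probability-measure-preserving invertible transformation $f:X\to X$, a cocycle $c:\mathbb{Z}\times X\to M=L^\infty(Y,\nu)$ with values in $M^\times\cap\mathrm{GL}^2(M,\tau)$, where $\tau(\phi)=\int\phi\,d\nu$ (so $c(n+m,x)=c(n,f^mx)c(m,x)$ for all $n,m\in\mathbb{Z}$ and a.e. $x$), measurable for the Strong Operator Topology and with $\int_X\|\log|c(1,x)|\|_2\,d\mu(x)<\infty$, and a vector $\xi\in L^2(Y,\nu)$ such that for a.e. $x\in X$ $$\lim_{n\to\infty}\|c(n,x)\xi\|_{L^2(Y,\nu)}^{1/n}=\lim_{n\to\infty}\|c(n,x)\|_{L^2(Y,\nu)}^{1/n}>\lim_{n\to\infty}\|\Lambda(x)^n\xi\|_{L^2(Y,\nu)}^{1/n}=\lim_{n\to\infty}\|\Lambda(x)^n\|_{L^2(Y,\nu)}^{1/n},$$ where $\Lambda(x)>0$ is the limit operator, $\log\Lambda(x)=\lim_{n\to\infty}n^{-1}\log|c(n,x)|$ in $L^2(Y,\nu)$. Moreover, the cocycle can be chosen so that $\|c(1,x)\|_\infty\le C$ for some constant $C$ and a.e. $x$. Moreover, for a.e. $x$, $n^{-1}\log|c(n,x)|$ does not converge to $\log\Lambda(x)$ in operator norm.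
   Context: $M=L^\infty(Y,\nu)$ acts on $L^2(Y,\nu)$ by multiplication; the operator norm of $\phi\in M$ is $\|\phi\|_\infty$. $M^\times$ is the set of $\phi\in L^\infty(Y,\nu)$ with $1/\phi\in L^\infty(Y,\nu)$. $\mathrm{GL}^2(M,\tau)$ is the set of a.e. nonzero measurable functions $\phi$ on $Y$ with $\log|\phi|\in L^2(Y,\nu)$. $\|c(n,x)\|_{L^2(Y,\nu)}$ and $\|\Lambda(x)^n\|_{L^2(Y,\nu)}$ denote the $L^2$-norms of the functions $c(n,x)$ and $\Lambda(x)^n$ on $Y$. *)

(* Defs.v *)
From HB Require Import structures.
From mathcomp Require Import all_boot all_order all_algebra.
From mathcomp Require Import complex.
From mathcomp Require Import all_classical all_reals all_analysis.

Set Implicit Arguments.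
Unset Strict Implicit.
Unset Printing Implicit Defensive.

Import Order.TTheory GRing.Theory Num.Theory.
Import numFieldNormedType.Exports.
Export Normc(normc).

Local Open Scope classical_set_scope.
Local Open Scope ring_scope.

(* A Hausdorff pseudometric space is metric. *)
Definition polish (R : realType) (P : completePseudoMetricType R) : Prop :=
  hausdorff_space P /\ exists2 D : set P, countable D & dense D.

Definition standard_borel (R : realType) (d : measure_display)
    (T : measurableType d) : Prop :=
  exists (P : completePseudoMetricType R) (h : T -> P),
    [/\ polish P, bijective h &
        forall A : set T, measurable A <-> <<s @open P >> (h @` A)].

Section Dynamics.
Context (R : realType) (d : measure_display) (X : measurableType d).
Context (mu : probability X R).

Definition pmp_invertible (f g : X -> X) : Prop :=
  [/\ cancel f g, cancel g f,
      measurable_fun setT f, measurable_fun setT g &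
      forall A, measurable A -> mu (f @^-1` A) = mu A].

Definition ergodic (f : X -> X) : Prop :=
  forall A, measurable A -> f @^-1` A = A -> mu A = 0%E \/ mu A = 1%E.

End Dynamics.

Definition ziter (T : Type) (f g : T -> T) (n : int) : T -> T :=
  match n with
  | Posz k => iter k f
  | Negz k => iter k.+1 g
  end.

(* Elements of L^oo(Y, nu) and L^2(Y, nu) are represented by measurable
   functions Y -> R[i]; nothing below distinguishes two measurable functions
   that are nu-a.e. equal. In particular, an [sot_open] set contains, with a
   function, every measurable function a.e. equal to it. *)
Section MultiplicationAlgebra.
Context (R : realType) (d : measure_display) (Y : measurableType d).
Context (nu : probability Y R).
Implicit Types phi psi xi : Y -> R[i].

Definition cmeasurable phi : Prop :=
  measurable_fun setT (fun y => complex.Re (phi y)) /\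
  measurable_fun setT (fun y => complex.Im (phi y)).

Definition cLnorm (p : \bar R) phi : \bar R :=
  Lnorm nu p (fun y => (normc (phi y))%:E).

Definition cLfun (p : \bar R) phi : Prop :=
  cmeasurable phi /\ (cLnorm p phi < +oo)%E.

Definition logabs phi : Y -> R := fun y => ln (normc (phi y)).

(* The condition phi y <> 0 a.e. is needed because 0^-1 = 0 in R[i]. *)
Definition Mx phi : Prop :=
  [/\ cLfun +oo%E phi, {ae nu, forall y, phi y <> 0} &
      cLfun +oo%E (fun y => (phi y)^-1)].

Definition GL2 phi : Prop :=
  [/\ cmeasurable phi, {ae nu, forall y, phi y <> 0} &
      logabs phi \in Lfun nu 2%:E].

(* Open sets of L^oo(Y, nu), acting on L^2(Y, nu) by multiplication, for the
   strong operator topology. *)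
Definition sot_open (U : set (Y -> R[i])) : Prop :=
  U `<=` cLfun +oo%E /\
  forall phi, U phi ->
    exists (k : nat) (xi : 'I_k -> Y -> R[i]) (e : R),
      [/\ forall i, cLfun 2%:E (xi i), 0 < e &
          forall psi, cLfun +oo%E psi ->
            (forall i, (cLnorm 2%:E (fun y => (psi y - phi y) * xi i y)%R
                        < e%:E)%E) ->
            U psi].

Definition sot_measurable (dX : measure_display) (X : measurableType dX)
    (F : X -> Y -> R[i]) : Prop :=
  forall B, <<s sot_open >> B -> measurable (F @^-1` B).

Definition cocycle (dX : measure_display) (X : measurableType dX)
    (mu : probability X R) (f g : X -> X) (c : int -> X -> Y -> R[i]) : Prop :=
  forall n m : int, {ae mu, forall x, {ae nu, forall y,
    c (n + m) x y = c n (ziter f g m x) y * c m x y}}.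

(* [L] is the positive operator with log L = lim_n n^-1 log |a n| in L^2. *)
Definition limit_operator (a : nat -> Y -> R[i]) (L : Y -> R) : Prop :=
  [/\ measurable_fun setT L, {ae nu, forall y, 0 < L y},
      (fun y => ln (L y)) \in Lfun nu 2%:E &
      Lnorm nu 2%:E (fun y => (n%:R^-1 * logabs (a n) y - ln (L y))%:E)
        @[n --> \oo] --> 0%E].

End MultiplicationAlgebra.

(* Main.v *)
Require Import Defs.
From HB Require Import structures.
From mathcomp Require Import all_boot all_order all_algebra.
From mathcomp Require Import complex.
From mathcomp Require Import all_classical all_reals all_analysis.
From mathcomp Require Import ess_sup_inf measurable_realfun.
From mathcomp Require Import zify ring lra.
Import Order.TTheory GRing.Theory Num.Theory.
Import numFieldNormedType.Exports.
Local Open Scope classical_set_scope.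
Local Open Scope ring_scope.

(** The base system is the odometer: [X] is the group of 2-adic integers with
    its Haar probability measure and [f x = x + 1].  The fibre [Y] is [nat],
    where the point [k] has mass [2 ^- k.+1].

    For [k = 4 * m + a] with [a < 4], let [height k x] be the distance from
    [x + a * 2 ^ m] to [0] in the cyclic group of order [q = 2 ^ m.+2].  The
    cocycle is the coboundary [c n x k = exp (height k (f^n x) - height k x)].
    Its logarithm [excess n x k] is at most [q] in absolute value, uniformly in
    [n], so [n^-1 * log |c n x|] tends to [0] at every [k].  It is also at most
    [|n|], since a unit step changes every height by exactly [1].  By dominated
    convergence the limit in [L^2] is [0], that is [Lambda = 1], and the two
    right-hand growth rates are [1] for [xi = 1].

    Conversely, the height climbs at unit speed for at least a quarter of a
    period from any point in the first quarter, and one of the four phases [a]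
    puts [x] there.  Hence for all [x] and all [n <= 2 ^ m] some [k] smaller than
    [4 * m.+1] has [excess n x k = n] ([excess_grow]).  This already rules out
    convergence in operator norm.  With [m] about [log n] the mass of [k] is at
    least a negative power of [n], so the [L^2] norm of [c n x] lies between
    [exp n] divided by a power of [n] and [exp n]: its [n]-th root tends to
    [exp 1 > 1] ([coc_growth]).

    Ergodicity: an invariant set meets all residue classes modulo [2 ^ M] in the
    same measure, so it is independent of every such class, hence of every
    measurable set, hence of itself ([dsucc_ergodic]).  Measurability for the
    strong operator topology: [c n x k] depends on finitely many digits of [x]
    once [k] is fixed, and the contribution of large [k] to an [L^2] norm is
    uniformly small, so preimages of strongly open sets are open
    ([coc_sot_open]). *)

(** * Tent functions on cyclic groups *)

Section Arithmetic.
Local Open Scope nat_scope.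

Lemma modn_expn2S s M :
  s %% 2 ^ M.+1 = s %% 2 ^ M + odd (s %/ 2 ^ M) * 2 ^ M.
Proof.
have p0 : 0 < 2 ^ M by rewrite expn_gt0.
rewrite [in LHS](divn_eq s (2 ^ M)) -[in LHS](odd_double_half (s %/ 2 ^ M)).
rewrite mulnDl -muln2 -mulnA -expnS addnAC [in LHS]addnC modnMDl modn_small 1?addnC//.
have := ltn_pmod s p0; rewrite expnS; case: odd => /=; lia.
Qed.

(** The distance from [t] to [0] in the cyclic group of order [q]. *)
Definition tent q t := minn (t %% q) (q - t %% q).

Lemma tent_mod q t : tent q (t %% q) = tent q t.
Proof. by rewrite /tent modn_mod. Qed.

Lemma tent_modDl q t s : tent q (t %% q + s) = tent q (t + s).
Proof. by rewrite -tent_mod modnDml tent_mod. Qed.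

Lemma tent_le q t : tent q t <= q.
Proof. by rewrite /tent geq_min leq_subr orbT. Qed.

(** The parity of [q] excludes two neighbours at the same distance from [0]. *)
Lemma tent_step q t : 0 < q -> ~~ odd q ->
  tent q t.+1 = (tent q t).+1 \/ tent q t = (tent q t.+1).+1.
Proof.
move=> q0 qe; rewrite /tent -addn1 -modnDml.
have := ltn_pmod t q0; move: (t %% q) => u uq.
have qE : q = q./2 * 2 by rewrite muln2 halfK (negbTE qe) subn0.
have [u1|u1] := ltnP (u + 1) q; first by rewrite (modn_small u1); lia.
by rewrite (_ : u + 1 = q) ?modnn; lia.
Qed.

(** From the first quarter of the period, the distance grows at unit speed for
    another quarter. *)
Lemma tent_grow q L t n : q = 4 * L -> t %% q < L -> n <= L ->
  tent q (t + n) = tent q t + n.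
Proof.
move=> qL tL nL; rewrite /tent -modnDml; move: (t %% q) tL => u uL.
by rewrite modn_small; lia.
Qed.

End Arithmetic.

(** A 2-adic integer is the sequence of its binary digits, least significant
    digit first. *)
Definition dyadic : Type := nat -> bool.

HB.instance Definition _ := gen_eqMixin dyadic.
HB.instance Definition _ := gen_choiceMixin dyadic.
HB.instance Definition _ := isPointed.Build dyadic (fun=> false).

Section Dyadic.
Local Open Scope nat_scope.
Implicit Types (x y : dyadic) (a : nat -> nat) (M N : nat).

(** [residue M x] is the representative of [x] modulo [2 ^ M] in
    [0, ..., 2 ^ M - 1]. *)
Definition residue M x : nat := \sum_(i < M) x i * 2 ^ i.

Lemma residue0 x : residue 0 x = 0.
Proof. by rewrite /residue big_ord0. Qed.

Lemma residueS M x : residue M.+1 x = residue M x + x M * 2 ^ M.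
Proof. by rewrite /residue big_ord_recr. Qed.

Lemma residue_lt M x : residue M x < 2 ^ M.
Proof.
elim: M => [|M IH]; first by rewrite residue0.
rewrite residueS expnS; case: (x M); lia.
Qed.

Lemma residue_modS M x : residue M.+1 x %% 2 ^ M = residue M x.
Proof. by rewrite residueS addnC modnMDl modn_small// residue_lt. Qed.

Lemma residue_mod M N x : M <= N -> residue N x %% 2 ^ M = residue M x.
Proof.
move=> /subnK <-; elim: (N - M) => [|k IH]; first by rewrite modn_small// residue_lt.
rewrite -IH -(residue_modS (k + M)) addSn modn_dvdm//.
by rewrite dvdn_exp2l// leq_addl.
Qed.

Lemma residue_le_eq M N x y : M <= N -> residue N x = residue N y ->
  residue M x = residue M y.
Proof. by move=> MN e; rewrite -(residue_mod M N)// e residue_mod. Qed.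

Lemma residue_digit M x y : (forall k, k < M -> x k = y k) <->
  residue M x = residue M y.
Proof.
split=> [xy|]; first by apply: eq_bigr => i _; rewrite xy.
elim: M => // M IH e k.
have eM : residue M x = residue M y by apply: residue_le_eq e.
rewrite ltnS leq_eqVlt => /predU1P[->|]; last exact: IH.
move: e; rewrite !residueS eM => /addnI.
have : 0 < 2 ^ M by rewrite expn_gt0.
by case: (x M); case: (y M); lia.
Qed.

Lemma residue_inj x y : (forall M, residue M x = residue M y) -> x = y.
Proof.
move=> xy; apply/funext => k.
by have /residue_digit := xy k.+1; exact.
Qed.

(** Translation by the 2-adic integer whose residue modulo [2 ^ M] is that of
    [a M]; this requires [a M.+1 = a M] modulo [2 ^ M]. *)
Definition translate a x : dyadic :=
  fun k => odd ((residue k.+1 x + a k.+1) %/ 2 ^ k).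

Lemma residue_translate a x M :
  (forall M, a M.+1 = a M %[mod 2 ^ M]) ->
  residue M (translate a x) = (residue M x + a M) %% 2 ^ M.
Proof.
move=> aP; elim: M => [|M IH]; first by rewrite !residue0 modn1.
rewrite residueS IH modn_expn2S /translate; congr (_ + _).
by rewrite -modnDm -(residue_modS M) modn_mod -aP modnDm.
Qed.

(** The odometer and its inverse: adding and subtracting [1]. *)
Definition dsucc := translate (fun=> 1).
Definition dpred := translate (fun M => 2 ^ M - 1).
Definition of_nat n : dyadic := translate (fun=> n) (fun=> false).

Lemma residue_succ M x : residue M (dsucc x) = (residue M x + 1) %% 2 ^ M.
Proof. exact: residue_translate. Qed.

Lemma residue_pred M x : residue M (dpred x) = (residue M x + (2 ^ M - 1)) %% 2 ^ M.
Proof.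
apply: residue_translate => {}M.
have p0 : 0 < 2 ^ M by rewrite expn_gt0.
have -> : 2 ^ M.+1 - 1 = 1 * 2 ^ M + (2 ^ M - 1) by rewrite expnS; lia.
by rewrite modnMDl.
Qed.

Lemma residue_of_nat M n : residue M (of_nat n) = n %% 2 ^ M.
Proof.
rewrite residue_translate//; congr (_ %% _).
by rewrite /residue big1 ?add0n.
Qed.

Lemma dsuccK : cancel dsucc dpred.
Proof.
move=> x; apply: residue_inj => M; rewrite residue_pred residue_succ modnDml.
have p0 : 0 < 2 ^ M by rewrite expn_gt0.
by rewrite -addnA subnKC// modnDr modn_small// residue_lt.
Qed.

Lemma dpredK : cancel dpred dsucc.
Proof.
move=> x; apply: residue_inj => M; rewrite residue_succ residue_pred modnDml.
have p0 : 0 < 2 ^ M by rewrite expn_gt0.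
by rewrite -addnA subnK// modnDr modn_small// residue_lt.
Qed.

Lemma residue_iter M n x :
  residue M (iter n dsucc x) = (residue M x + n) %% 2 ^ M.
Proof.
elim: n => [|n IH] /=; first by rewrite addn0 modn_small// residue_lt.
by rewrite residue_succ IH modnDml addn1 addnS.
Qed.

Lemma residue_ziter_eq M (n : int) x y : residue M x = residue M y ->
  residue M (ziter dsucc dpred n x) = residue M (ziter dsucc dpred n y).
Proof.
move=> xy; case: n => n /=; first by rewrite !residue_iter xy.
elim: n => [|n IH] /=; first by rewrite !residue_pred xy.
by rewrite residue_pred IH -residue_pred.
Qed.

(** Writing [k = 4 * m + a] with [a < 4], this is the distance from
    [x + a * 2 ^ m] to [0] modulo [2 ^ m.+2]: the index [k] encodes the scale
    [m] and one of four phases, a quarter of a period apart. *)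
Definition height k x : nat :=
  tent (2 ^ (k %/ 4).+2) (residue (k %/ 4).+2 x + k %% 4 * 2 ^ (k %/ 4)).

Lemma height_le k x : height k x <= 2 ^ (k %/ 4).+2.
Proof. exact: tent_le. Qed.

Lemma height_residue k x y :
  residue (k %/ 4).+2 x = residue (k %/ 4).+2 y -> height k x = height k y.
Proof. by rewrite /height => ->. Qed.

Lemma height_succ k x :
  height k (dsucc x) = (height k x).+1 \/ height k x = (height k (dsucc x)).+1.
Proof.
rewrite /height residue_succ tent_modDl addn1 addSn; apply: tent_step.
  by rewrite expn_gt0.
by rewrite oddX.
Qed.

(** One of the four phases puts [x] in the first quarter of the period, from
    which the height climbs during at least [2 ^ m] steps. *)
Lemma height_grow m n x : n <= 2 ^ m ->
  exists2 k, k < 4 * m.+1 & height k (iter n dsucc x) = height k x + n.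
Proof.
move=> nm; set L := 2 ^ m in nm *.
have L0 : 0 < L by rewrite expn_gt0.
have qL : 2 ^ m.+2 = 4 * L by rewrite !expnS /L; lia.
pose r := residue m.+2 x; have rq : r < 4 * L by rewrite -qL residue_lt.
(* The phase that moves the quarter containing [r] onto the first one. *)
pose a := (4 - r %/ L) %% 4.
have a4 : a < 4 by rewrite ltn_mod.
exists (m * 4 + a); first lia.
rewrite /height divnMDl// (divn_small a4) addn0 modnMDl (modn_small a4).
rewrite residue_iter tent_modDl addnAC -/r -/L.
apply: (@tent_grow _ L) => //; rewrite qL.
have : (r + a * L) = ((r %/ L + a) * L + r %% L) by rewrite mulnDl addnAC -divn_eq.
have rL := ltn_pmod r L0.
have : r %/ L < 4 by rewrite ltn_divLR.
rewrite /a; move: (r %% L) rL (r %/ L) => u uL [|[|[|[|//]]]] _ -> /=.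
- by rewrite (_ : (4 - 0) %% 4 = 0)// modn_small; lia.
- rewrite (_ : (1 + _) * L + u = 1 * (4 * L) + u) ?modnMDl ?modn_small//; lia.
- rewrite (_ : (2 + _) * L + u = 1 * (4 * L) + u) ?modnMDl ?modn_small//; lia.
- rewrite (_ : (3 + _) * L + u = 1 * (4 * L) + u) ?modnMDl ?modn_small//; lia.
Qed.

End Dyadic.

(** * The space of 2-adic integers *)

(** The 2-adic uniformity: an entourage contains all pairs of points that are
    congruent modulo some [2 ^ M]. *)
Definition dyadic_ent : set_system (dyadic * dyadic) :=
  [set A | exists M, forall x y, residue M x = residue M y -> A (x, y)].

Lemma dyadic_ent_filter : Filter dyadic_ent.
Proof.
split=> [|A B [M AM] [N BN]|A B AB [M AM]].
- by exists 0%N.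
- exists (maxn M N) => x y xy; split.
    by apply: AM; apply: residue_le_eq xy; rewrite leq_maxl.
  by apply: BN; apply: residue_le_eq xy; rewrite leq_maxr.
- by exists M => x y /AM/AB.
Qed.

Lemma dyadic_ent_diagonal A : dyadic_ent A -> diagonal `<=` A.
Proof. by move=> [M AM] [x y] xy; apply: AM; rewrite (xy : x = y). Qed.

Lemma dyadic_ent_inv A : dyadic_ent A -> dyadic_ent A^-1%relation.
Proof. by move=> [M AM]; exists M => x y xy; exact: AM. Qed.

Lemma dyadic_ent_split A : dyadic_ent A ->
  exists2 B, dyadic_ent B & (B \; B `<=` A)%relation.
Proof.
move=> [M AM]; exists [set xy | residue M xy.1 = residue M xy.2].
  by exists M.
by move=> [x y] [z xz zy]; apply: AM; exact: etrans xz zy.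
Qed.

HB.instance Definition _ := isUniform.Build dyadic dyadic_ent_filter
  dyadic_ent_diagonal dyadic_ent_inv dyadic_ent_split.

(** The ball of radius [e > 0] is a congruence class modulo [2 ^ M], with [M]
    the largest integer satisfying [e * M.+1 <= 1] (the whole space if
    [e > 1]).  Balls of nonpositive radius are empty. *)
Definition dyadic_ball {R : numDomainType} (x : dyadic) (e : R) (y : dyadic) :=
  0 < e /\ forall M : nat, e * M.+1%:R <= 1 -> residue M x = residue M y.

Section Ball.
Context (R : realType).
Implicit Types (x y z : dyadic) (e : R).

Lemma dyadic_ball_center x e : 0 < e -> dyadic_ball x e x.
Proof. by []. Qed.

Lemma dyadic_ball_sym x y e : dyadic_ball x e y -> dyadic_ball y e x.
Proof. by move=> [e0 xy]; split=> // M /xy. Qed.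

Lemma dyadic_ball_triangle x y z e1 e2 :
  dyadic_ball x e1 y -> dyadic_ball y e2 z -> dyadic_ball x (e1 + e2) z.
Proof.
move=> [e10 xy] [e20 yz]; split=> [|M]; first exact: addr_gt0.
rewrite mulrDl => eM; rewrite xy ?yz//; apply: le_trans eM.
  by rewrite lerDr mulr_ge0// ltW.
by rewrite lerDl mulr_ge0// ltW.
Qed.

Lemma dyadic_entourageE : entourage = entourage_ (@dyadic_ball R).
Proof.
apply/seteqP; split=> A [].
  move=> M AM; exists (M.+1%:R^-1) => /=; first by rewrite invr_gt0.
  by move=> [x y] [_ /(_ M)] /=; rewrite mulVf// => /(_ (lexx _))/AM.
move=> e /= e0 eA; exists (Num.bound e^-1) => x y xy; apply: eA; split=> //= M eM.
apply: residue_le_eq xy; rewrite -(ler_nat R).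
have := archi_boundP (ltW (_ : 0 < e^-1)); rewrite invr_gt0 => /(_ e0) /ltW.
apply: le_trans; rewrite -[leRHS]mul1r ler_pdivlMr// mulrC (le_trans _ eM)//.
by rewrite ler_pM2l// ler_nat.
Qed.

End Ball.

HB.instance Definition _ (R : realType) :=
  Uniform_isPseudoMetric.Build R dyadic (dyadic_ball_center R)
    (dyadic_ball_sym R) (dyadic_ball_triangle R) (dyadic_entourageE R).

Lemma dyadic_nbhsP (x : dyadic) (A : set dyadic) :
  nbhs x A <-> exists M, forall y, residue M x = residue M y -> A y.
Proof.
split=> [/nbhsP[B [M BM] BA]|[M AM]].
  by exists M => y xy; apply/BA/xsectionP/BM.
apply/nbhsP; exists [set yz | residue M yz.1 = residue M yz.2]; first by exists M.
by move=> y /xsectionP/AM.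
Qed.

(** Each digit of the limit is the one that the filter eventually selects. *)
Lemma dyadic_complete (F : set_system dyadic) :
  ProperFilter F -> cauchy F -> cvg F.
Proof.
move=> FF cF; pose x : dyadic := fun k => `[< F [set y | y k] >].
apply/cvg_ex; exists x => A /dyadic_nbhsP[M AM].
have /cF[[B C] [/= FB FC] BC] :
  entourage [set yz : dyadic * dyadic | residue M yz.1 = residue M yz.2].
  by exists M.
have [z Cz] := filter_ex FC.
apply: filterS (FB) => y By; apply: AM.
have {y By}-> : residue M y = residue M z by exact: (BC (y, z)).
apply/residue_digit => k kM.
have Fz : F [set y : dyadic | y k = z k].
  apply: filterS (FB) => y By.
  by have /residue_digit := BC (y, z) (conj By Cz); exact.
rewrite /x; case zk : (z k) Fz => Fz; first exact/asboolP.
apply/asboolP => Fk; have [y []] := filter_ex (filterI Fz Fk).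
by rewrite /= => ->.
Qed.

HB.instance Definition _ := Uniform_isComplete.Build dyadic dyadic_complete.

Lemma dyadic_hausdorff : hausdorff_space dyadic.
Proof.
move=> x y xy; apply: residue_inj => M.
have [] := xy [set z | residue M x = residue M z] [set z | residue M y = residue M z].
- by apply/dyadic_nbhsP; exists M.
- by apply/dyadic_nbhsP; exists M.
- by move=> z [/= -> ->].
Qed.

Lemma dyadic_dense : dense (range of_nat).
Proof.
move=> O [x Ox] oO.
have /dyadic_nbhsP[M MO] : nbhs x O by exact: open_nbhs_nbhs.
exists (of_nat (residue M x)); split; last by exists (residue M x).
by apply: MO; rewrite residue_of_nat modn_small// residue_lt.
Qed.

Lemma dyadic_polish (R : realType) : @polish R dyadic.
Proof.
split; first exact: dyadic_hausdorff.
exists (range of_nat); last exact: dyadic_dense.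
exact: card_image_le.
Qed.

(** Residue classes modulo [2 ^ M]; they form a pi-system that generates the
    Borel sets. *)
Definition level M j : set dyadic := [set x | residue M x = j].

Definition levels : set (set dyadic) := [set A | exists M j, A = level M j].

Lemma level_levels M j : levels (level M j).
Proof. by exists M, j. Qed.

Lemma level_open M j : open (level M j).
Proof.
rewrite openE => x <-; apply/dyadic_nbhsP; exists M => y xy.
by rewrite /level /= xy.
Qed.

Lemma level_set0 : level 0 1 = set0.
Proof. by apply/seteqP; split=> x //; rewrite /level /= residue0. Qed.

Lemma level_setT : level 0 0 = setT.
Proof. by apply/seteqP; split=> x // _; rewrite /level /= residue0. Qed.

Lemma level_setI M N i j : (M <= N)%N ->
  level M i `&` level N j = if (j %% 2 ^ M == i)%N then level N j else set0.
Proof.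
move=> MN; apply/seteqP; split=> [x [/= <- <-]|x].
  by rewrite residue_mod// eqxx.
by case: eqP => //= <- <-; rewrite /level /= residue_mod.
Qed.

Lemma levels_setI : setI_closed levels.
Proof.
move=> _ _ [M [i ->]] [N [j ->]].
wlog MN : M N i j / (M <= N)%N => [h|].
  by have [/h//|/ltnW/h] := leqP M N; rewrite setIC.
by rewrite level_setI//; case: ifP => _; [|rewrite -level_set0]; exact: level_levels.
Qed.

(** The 2-adic integers with the sigma-algebra generated by residue classes. *)
Definition dyadicm := g_sigma_algebraType levels.

Lemma level_measurable M j : measurable (level M j : set dyadicm).
Proof. by apply: sub_sigma_algebra; exact: level_levels. Qed.

(** An open set is a countable union of residue classes. *)
Lemma open_levelsE (O : set dyadic) : open O ->
  O = \bigcup_M \bigcup_(j in [set j | level M j `<=` O]) level M j.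
Proof.
move=> oO; apply/seteqP; split=> [x Ox|x [M _ [j jO]]]; last exact: jO.
have /dyadic_nbhsP[M MO] : nbhs x O by exact: open_nbhs_nbhs.
by exists M => //; exists (residue M x) => // y /= yx; apply: MO; rewrite yx.
Qed.

Lemma open_dyadic_measurable (O : set dyadic) : open O ->
  measurable (O : set dyadicm).
Proof.
move=> /open_levelsE ->; apply: bigcupT_measurable => M.
by apply: bigcup_measurable => j _; exact: level_measurable.
Qed.

Lemma dyadic_standard_borel (R : realType) : standard_borel R dyadicm.
Proof.
exists dyadic, id; split=> [||A].
- exact: dyadic_polish.
- by exists id.
- rewrite image_id; split.
    apply: smallest_sub; first exact: smallest_sigma_algebra.
    by move=> _ [M [j ->]]; apply: sub_sigma_algebra; exact: level_open.
  apply: smallest_sub; first exact: sigma_algebra_measurable.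
  exact: open_dyadic_measurable.
Qed.

Lemma measurable_levels (f : dyadic -> dyadic) :
  (forall M j, measurable (f @^-1` level M j : set dyadicm)) ->
  measurable_fun setT (f : dyadicm -> dyadicm).
Proof.
move=> fm; apply: (@measurability _ _ dyadicm dyadicm _ _ levels) => // _ [_ [M [j ->]] <-].
by rewrite setTI.
Qed.

(** A map that acts on residues modulo every [2 ^ M] is measurable. *)
Lemma measurable_residue (f : dyadic -> dyadic) (phi : nat -> nat -> nat) :
  (forall M x, residue M (f x) = phi M (residue M x)) ->
  measurable_fun setT (f : dyadicm -> dyadicm).
Proof.
move=> fphi; apply: measurable_levels => M j.
rewrite (_ : _ @^-1` _ = \bigcup_(i in [set i | phi M i = j]) level M i).
  by apply: bigcup_measurable => i _; exact: level_measurable.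
apply/seteqP; split=> [x /= <-|x [i /= <- <-]]; last by rewrite /level /= fphi.
by exists (residue M x) => //=; rewrite -fphi.
Qed.

Lemma measurable_dsucc : measurable_fun setT (dsucc : dyadicm -> dyadicm).
Proof. exact: (measurable_residue _ (fun M i => (i + 1) %% 2 ^ M)%N residue_succ). Qed.

Lemma measurable_dpred : measurable_fun setT (dpred : dyadicm -> dyadicm).
Proof. exact: (measurable_residue _ (fun M i => (i + (2 ^ M - 1)) %% 2 ^ M)%N residue_pred). Qed.

Lemma nat_complete (F : set_system nat) : ProperFilter F -> cauchy F -> cvg F.
Proof.
move=> FF cF.
have /cF[[B C] [/= FB FC] BC] : entourage (range (fun x : nat => (x, x))).
  by rewrite uniform_discrete.
have [n Cn] := filter_ex FC.
apply/cvg_ex; exists n => A; rewrite nbhs_principalE => /principal_filterP An.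
by apply: filterS FB => m Bm; have [k _ [<- kn]] := BC (m, n) (conj Bm Cn); rewrite kn.
Qed.

HB.instance Definition _ := Uniform_isComplete.Build nat nat_complete.

Lemma nat_standard_borel (R : realType) : standard_borel R nat.
Proof.
exists nat, id; split=> [||A].
- split; first exact: discrete_hausdorff.
  by exists setT; [exact: countableP|move=> O [n On] _; exists n].
- by exists id.
- rewrite image_id; split=> // _; apply: sub_sigma_algebra.
  exact: discrete_open.
Qed.

(** * Haar measure and ergodicity of the odometer *)

Section DyadicMeasure.
Context (R : realType).
Local Notation itv01 := (`[0, 1[%classic : set R).

(** The binary expansion of [t] in [0, 1[, read as a 2-adic integer whose least
    significant digit is the first digit after the point.  Outside [0, 1[ the
    value is [0]. *)
Definition digits (t : R) : dyadic :=
  fun k => (0 <= t < 1) && odd (Num.truncn (2 ^+ k.+1 * t)).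

Lemma truncn_half (t : R) : 0 <= t -> (Num.truncn (2 * t))./2 = Num.truncn t.
Proof.
move=> t0; apply/esym/truncn_def; set n := Num.truncn (2 * t).
have /andP[nt tn] : n%:R <= 2 * t < n.+1%:R by apply: truncn_itv; rewrite mulr_ge0.
have := odd_double_half n; case: odd => /= nE.
  have : n%:R = 1 + 2 * (n./2)%:R :> R by rewrite -{1}nE -muln2 natrD natrM mulrC.
  rewrite -!natr1 in tn *; lra.
have : n%:R = 2 * (n./2)%:R :> R by rewrite -{1}nE add0n -muln2 natrM mulrC.
rewrite -!natr1 in tn *; lra.
Qed.

(** Fixing a residue modulo [2 ^ M] amounts to fixing the first [M] binary
    digits of [t], that is the integer part of [2 ^ M * t]; the witness [i] is
    the bit reversal of [j]. *)
Lemma digits_level M j : (j < 2 ^ M)%N -> exists2 i, (i < 2 ^ M)%N &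
  forall t, 0 <= t < 1 ->
    (residue M (digits t) = j <-> Num.truncn (2 ^+ M * t) = i).
Proof.
elim: M j => [|M IH] j jM.
  exists 0%N => // t t01; rewrite residue0 expr0 mul1r.
  have -> : Num.truncn t = 0%N by apply: truncn_def.
  by move: jM; case: j.
have p0 : (0 < 2 ^ M)%N by rewrite expn_gt0.
have [i iM IHi] := IH _ (ltn_pmod j p0).
set b := odd (j %/ 2 ^ M).
exists (b + i.*2)%N => [|t t01].
  by rewrite expnS; case: b; lia.
have jE : j = (j %% 2 ^ M + b * 2 ^ M)%N by rewrite -modn_expn2S modn_small.
have t0 : 0 <= 2 ^+ M * t by rewrite mulr_ge0 ?exprn_ge0//; case/andP: t01.
have := IHi t t01; rewrite -(truncn_half _ t0) mulrA -exprS.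
have := residue_lt M (digits t); have := ltn_pmod j p0.
set n := Num.truncn _; have nE := odd_double_half n.
have -> : residue M.+1 (digits t) = (residue M (digits t) + odd n * 2 ^ M)%N.
  by rewrite residueS /digits t01.
rewrite [in _ = j]jE.
move: (residue _ _) (j %% _)%N => r s sM rM [ri ir]; split=> h.
  have rs : r = s by case: (odd n) (b) h => [] []; lia.
  have ob : odd n = b by move: h; rewrite rs; case: (odd n) (b) => [] []; lia.
  by rewrite -nE ob ri.
have ob : odd n = b by rewrite h oddD odd_double addbF oddb.
rewrite ir ?ob// h halfD odd_double andbF add0n doubleK.
by case: (b).
Qed.

Lemma digits_preimage M j : (j < 2 ^ M)%N -> exists2 i, (i < 2 ^ M)%N &
  digits @^-1` level M j `&` `[0, 1[%classic =
  `[i%:R / 2 ^+ M, i.+1%:R / 2 ^+ M[%classic.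
Proof.
move=> /digits_level[i iM iP]; exists i => //.
have p0 : 0 < 2 ^+ M :> R by rewrite exprn_gt0.
apply/seteqP; split=> t /=; rewrite !in_itv /=.
  move=> [jt t01]; rewrite ler_pdivrMr// ltr_pdivlMr// mulrC.
  have [/(_ jt) iE _] := iP t t01; rewrite -iE; apply: truncn_itv.
  by rewrite mulr_ge0 ?exprn_ge0//; case/andP: t01.
move=> /andP[it ti].
have t01 : 0 <= t < 1.
  apply/andP; split; first by rewrite (le_trans _ it)// divr_ge0// ltW.
  rewrite (lt_le_trans ti)// ler_pdivrMr// mul1r -natrX ler_nat//.
split=> //; apply/iP => //; apply: truncn_def.
by rewrite mulrC -ler_pdivrMr// -ltr_pdivlMr// it.
Qed.

Lemma digits_out t : ~~ (0 <= t < 1) -> digits t = fun=> false.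
Proof. by move=> /negbTE t01; apply/funext => k; rewrite /digits t01. Qed.

Lemma measurable_digits : measurable_fun setT (digits : _ -> dyadicm).
Proof.
apply: (@measurability _ _ (measurableTypeR R) dyadicm _ _ levels) => // _ [_ [M [j ->]] <-].
rewrite setTI -(setIT (_ @^-1` _)) -(setUv `[0%R, 1%R[%classic) setIUr.
apply: measurableU.
  have [/digits_preimage[i _ ->]|jM] := ltnP j (2 ^ M); first exact: measurable_itv.
  rewrite (_ : _ `&` _ = set0)//; apply/seteqP; split=> t //= [rj _].
  by have := residue_lt M (digits t); rewrite rj; lia.
have [j0|j0] := eqVneq (residue M (fun=> false)) j.
  rewrite setIidr; first by apply: measurableC; exact: measurable_itv.
  by move=> t /=; rewrite in_itv /= => /negP/digits_out; rewrite /level /= => ->.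
rewrite (_ : _ `&` _ = set0)//; apply/seteqP; split=> t //= [rj].
by rewrite in_itv /= => /negP/digits_out dt; move: rj; rewrite /level /= dt => /eqP; rewrite (negbTE j0).
Qed.

(** Lebesgue measure on [0, 1[. *)
Definition lebesgue01 : set (measurableTypeR R) -> \bar R :=
  mrestr (@lebesgue_measure R) (measurable_itv `[0%R, 1%R[).

HB.instance Definition _ := Measure.on lebesgue01.

Let lebesgue01_setT : lebesgue01 setT = 1%E.
Proof.
by rewrite /lebesgue01 /mrestr setTI lebesgue_measure_itv /= lte_fin ltr01 sube0.
Qed.

HB.instance Definition _ := Measure_isProbability.Build _ _ _ lebesgue01
  lebesgue01_setT.

Let digitsm : measurableTypeR R -> dyadicm := digits.

HB.instance Definition _ := isMeasurableFun.Build _ _ _ _ digitsm measurable_digits.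

(** Haar measure on the 2-adic integers is the law of the binary digits of a
    uniform random point of [0, 1[. *)
Definition haar : probability dyadicm R :=
  distribution lebesgue01 digitsm.

Lemma haar_level M j : (j < 2 ^ M)%N -> haar (level M j) = (2 ^- M)%:E.
Proof.
move=> jM.
rewrite -[LHS]/(@lebesgue_measure R (digits @^-1` level M j `&` `[0, 1[%classic)).
have [i iM ->] := digits_preimage M j jM.
have p0 : 0 < 2 ^- M :> R by rewrite invr_gt0 exprn_gt0.
rewrite lebesgue_measure_itv /= lte_fin ltr_pM2r// ltr_nat ltnSn.
by rewrite -EFinB -mulrBl -natr1 addrAC subrr add0r mul1r.
Qed.

Lemma level_ge M j : (2 ^ M <= j)%N -> level M j = set0.
Proof.
move=> jM; apply/seteqP; split=> // x xj.
by have := residue_lt M x; rewrite (xj : residue M x = j) ltnNge jM.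
Qed.

(** A finite measure is determined by its values on residue classes. *)
Lemma dyadic_measure_unique (m1 m2 : {measure set dyadicm -> \bar R}) :
  (forall M j, (j < 2 ^ M)%N -> m1 (level M j) = m2 (level M j)) ->
  (m1 setT < +oo)%E ->
  forall A, measurable A -> m1 A = m2 A.
Proof.
move=> m12 m1oo; apply: (@measure_unique _ R dyadicm levels (fun=> level 0 0)) => //.
- exact: levels_setI.
- by move=> _; exact: level_levels.
- by rewrite bigcup_const ?level_setT//; exists 0%N.
- move=> _ [M [j ->]]; have [/m12//|jM] := ltnP j (2 ^ M).
  by rewrite level_ge// !measure0.
- by move=> _; rewrite level_setT.
Qed.

Let dsuccm : dyadicm -> dyadicm := dsucc.

HB.instance Definition _ := isMeasurableFun.Build _ _ _ _ dsuccm measurable_dsucc.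

Lemma dsucc_preimage_level M j : (j < 2 ^ M)%N ->
  dsucc @^-1` level M j = level M (residue M (dpred (of_nat j))).
Proof.
move=> jM; have jE : residue M (of_nat j) = j by rewrite residue_of_nat modn_small.
apply/seteqP; split=> x; rewrite /level /=.
  rewrite -{1}jE => /(residue_ziter_eq M (Negz 0)) /=.
  by rewrite dsuccK.
by move/(residue_ziter_eq M (Posz 1)) => /= ->; rewrite dpredK.
Qed.

Lemma haar_dsucc (A : set dyadicm) : measurable A -> haar (dsucc @^-1` A) = haar A.
Proof.
move=> mA; rewrite -[LHS]/(distribution haar dsuccm A).
apply: dyadic_measure_unique => // [M j jM|].
  rewrite -[LHS]/(haar (dsucc @^-1` level M j)) dsucc_preimage_level//.
  rewrite haar_level; last exact: residue_lt.
  exact/esym/haar_level.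
by rewrite (le_lt_trans (probability_le1 _ _))// ltry.
Qed.

Lemma dsucc_pmp : pmp_invertible haar dsucc dpred.
Proof.
split.
- exact: dsuccK.
- exact: dpredK.
- exact: measurable_dsucc.
- exact: measurable_dpred.
- exact: haar_dsucc.
Qed.

Lemma levelS M j : (j < 2 ^ M)%N ->
  level M j = level M.+1 j `|` level M.+1 (j + 2 ^ M).
Proof.
move=> jM; apply/seteqP; split=> x; rewrite /level /= residueS.
  by move=> ->; case: (x M); [right|left]; rewrite ?mul1n ?mul0n ?addn0.
have := residue_lt M x.
by case: (x M) => /= h []; lia.
Qed.

(** An invariant set has the same measure in all [2 ^ M] residue classes. *)
Lemma haar_invariant_level (A : set dyadicm) : measurable A -> dsucc @^-1` A = A ->
  forall M j, (j < 2 ^ M)%N ->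
  haar (A `&` level M j) = (haar A * (2 ^- M)%:E)%E.
Proof.
move=> mA fA.
have mAl M j : measurable (A `&` level M j).
  by apply: measurableI => //; exact: level_measurable.
have shift M j : (j.+1 < 2 ^ M)%N ->
    haar (A `&` level M j.+1) = haar (A `&` level M j).
  move=> jM; rewrite -haar_dsucc// preimage_setI fA dsucc_preimage_level//.
  by rewrite residue_pred residue_of_nat (modn_small jM); congr (haar (_ `&` level _ _)); 
    rewrite addSnnS addnC -subSn ?expn_gt0// subSS subn0 modnDl modn_small// ltnW.
have const M j : (j < 2 ^ M)%N -> haar (A `&` level M j) = haar (A `&` level M 0).
  by elim: j => // j IH jM; rewrite shift// IH// ltnW.
elim=> [|M IH] j jM.
  by rewrite const// level_setT setIT expr0 invr1 mule1.
have p0 : (0 < 2 ^ M)%N by rewrite expn_gt0.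
(* A class modulo [2 ^ M] is the union of two classes modulo [2 ^ M.+1]. *)
have split0 : haar (A `&` level M 0) =
    (haar (A `&` level M.+1 0) + haar (A `&` level M.+1 0))%E.
  rewrite levelS// setIUr measureU//.
    rewrite add0n; congr (_ + _)%E; apply: (const M.+1 (2 ^ M)%N).
    by rewrite expnS; lia.
  by apply/seteqP; split=> // x [[_ /= h] [_]]; rewrite /level /= in h *; lia.
rewrite const//; have := IH _ p0; rewrite split0.
have finA B : measurable B -> haar B \is a fin_num by move=> ?; exact: fin_num_measure.
rewrite -(fineK (finA _ (mAl M.+1 0%N))) -(fineK (finA _ mA)).
rewrite -EFinD -!EFinM => -[h]; congr EFin.
rewrite exprS invfM; lra.
Qed.

(** The measures [haar (A `&` B)] and [haar A * haar B] of [B] agree on residue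
    classes, hence everywhere; [B = A] gives [haar A = haar A ^ 2]. *)
Lemma dsucc_ergodic : ergodic haar dsucc.
Proof.
move=> A mA fA; have Alevel := haar_invariant_level A mA fA.
have fA01 : haar A \is a fin_num by exact: fin_num_measure.
pose r : {nonneg R} := NngNum (fine_ge0 (measure_ge0 haar A)).
have : mrestr haar mA A = mscale r haar A.
  apply: dyadic_measure_unique => // [M j jM|].
    rewrite -[LHS]/(haar (level M j `&` A)) setIC Alevel//.
    rewrite -[RHS]/((fine (haar A))%:E * haar (level M j))%E fineK//.
    by rewrite haar_level.
  rewrite -[ltLHS]/(haar (setT `&` A)) setTI.
  by rewrite (le_lt_trans (probability_le1 haar mA))// ltry.
rewrite -[X in X = _]/(haar (A `&` A)) -[X in _ = X]/((fine (haar A))%:E * haar A)%E.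
rewrite setIid -(fineK fA01) -EFinM /= => -[].
move=> /eqP; rewrite -subr_eq0 -{1}[fine _]mulr1 -mulrBr mulf_eq0 subr_eq0.
by move=> /orP[]/eqP; [move=> ->; left|move=> <-; right].
Qed.

End DyadicMeasure.

Section Geometric.
Context (R : realType).

Let weight_ge0 (k : nat) : 0 <= 2 ^- k.+1 :> R.
Proof. by rewrite invr_ge0 exprn_ge0. Qed.

(** The probability on [nat] with mass [2 ^- k.+1] at [k]. *)
Definition geom : set nat -> \bar R :=
  mseries (fun k => mscale (NngNum (weight_ge0 k)) (@dirac _ nat k R)) 0.

HB.instance Definition _ := Measure.on geom.

Let geom_setT : geom setT = 1%E.
Proof.
rewrite /geom /mseries; have := @cvg_geometric_eseries_half R 1 0.
rewrite expr0 divr1 => /cvg_lim <- //.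
apply/congr_lim/funext => n; apply: eq_bigr => k _.
have kT : @dirac _ nat k R setT = 1%E by rewrite diracT.
by rewrite -[LHS]/((2 ^- k.+1)%:E * @dirac _ nat k R setT)%E kT mule1 addn1 div1r natrX.
Qed.

HB.instance Definition _ := Measure_isProbability.Build _ _ _ geom geom_setT.

Lemma geom_set1 k : ((2 ^- k.+1)%:E <= geom [set k])%E.
Proof.
rewrite /geom /mseries; apply: le_trans (nneseries_lim_ge k.+1 _) => //.
rewrite big_nat_recr//= /mscale /= diracE mem_set//= mule1 leeDr//.
by apply: sume_ge0 => i _; rewrite mule_ge0// lee_fin.
Qed.

(** Every point has positive mass, so a null set is empty. *)
Lemma geom_ae (P : nat -> Prop) : {ae geom, forall k, P k} -> forall k, P k.
Proof.
move=> [N [mN N0 PN]] k; apply: contrapT => nPk.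
have : (geom [set k] <= geom N)%E.
  by apply: le_measure; rewrite ?inE// => _ ->; exact: PN.
rewrite N0 leNgt => /negP; apply; apply: lt_le_trans (geom_set1 k).
by rewrite lte_fin invr_gt0 exprn_gt0.
Qed.

End Geometric.

(** * L2 norms over a probability space *)

Section L2norm.
Context {R : realType} {d} {Y : measurableType d} (nu : probability Y R).
Implicit Types f g h : Y -> R.

Lemma Lnorm2E h : Lnorm nu 2%:E (fun y => (h y)%:E) =
  ((\int[nu]_y (h y ^+ 2)%:E) `^ 2^-1)%E.
Proof.
rewrite unlock; congr (_ `^ _)%E; apply: eq_integral => y _.
by rewrite abse_EFin poweR_EFin powR_mulrn// real_normK// num_real.
Qed.

Lemma le_Lnorm2 f g : measurable_fun setT f -> measurable_fun setT g ->
  (forall y, `|f y| <= `|g y|) ->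
  (Lnorm nu 2%:E (fun y => (f y)%:E) <= Lnorm nu 2%:E (fun y => (g y)%:E))%E.
Proof.
move=> mf mg fg; rewrite !Lnorm2E.
have I0 h : (0 <= \int[nu]_y (h y ^+ 2)%:E)%E.
  by apply: integral_ge0 => y _; rewrite lee_fin sqr_ge0.
apply: gt0_ler_poweR; rewrite ?in_itv /= ?leey ?I0 ?invr_ge0//.
apply: ge0_le_integral => //.
- by move=> y _; rewrite lee_fin sqr_ge0.
- by apply/measurable_EFinP; exact: measurable_funX.
- by apply/measurable_EFinP; exact: measurable_funX.
- move=> y _; rewrite lee_fin -[leLHS]real_normK ?num_real// -[leRHS]real_normK ?num_real//.
  by rewrite ler_sqr ?nnegrE.
Qed.

Lemma Lnorm2_cst C : 0 <= C -> Lnorm nu 2%:E (fun=> C%:E) = C%:E.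
Proof.
move=> C0; rewrite Lnorm2E integral_cst//= probability_setT mule1 poweR_EFin.
by rewrite powR12_sqrt ?sqr_ge0// sqrtr_sqr ger0_norm.
Qed.

Lemma Lnorm2_le f C : measurable_fun setT f -> (forall y, `|f y| <= C) ->
  (Lnorm nu 2%:E (fun y => (f y)%:E) <= C%:E)%E.
Proof.
move=> mf fC; have C0 : 0 <= C by rewrite (le_trans _ (fC point)).
rewrite -[leRHS]Lnorm2_cst//; apply: le_Lnorm2 => // y.
by rewrite (ger0_norm C0).
Qed.

(** The norm of [f] is bounded below by the contribution of a set of measure
    at least [p] on which [|f|] is at least [a]. *)
Lemma Lnorm2_ge f (A : set Y) (a b p : R) : measurable_fun setT f ->
  measurable A -> (p%:E <= nu A)%E -> (forall y, A y -> a <= `|f y|) ->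
  0 <= a -> 0 <= b -> b ^+ 2 <= a ^+ 2 * p ->
  (b%:E <= Lnorm nu 2%:E (fun y => (f y)%:E))%E.
Proof.
move=> mf mA pA af a0 b0 bap; rewrite Lnorm2E.
have {1}-> : b = (b ^+ 2) `^ 2^-1.
  by rewrite powR12_sqrt ?sqr_ge0// sqrtr_sqr ger0_norm.
rewrite -poweR_EFin.
have I0 : (0 <= \int[nu]_y (f y ^+ 2)%:E)%E.
  by apply: integral_ge0 => y _; rewrite lee_fin sqr_ge0.
apply: gt0_ler_poweR; rewrite ?in_itv /= ?leey ?I0 ?invr_ge0 ?lee_fin ?sqr_ge0//.
have mf2 : measurable_fun setT (fun y => (f y ^+ 2)%:E).
  by apply/measurable_EFinP; exact: measurable_funX.
have f20 (y : Y) : (0 <= (f y ^+ 2)%:E)%E by rewrite lee_fin sqr_ge0.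
apply: (@le_trans _ _ (\int[nu]_(y in A) (f y ^+ 2)%:E)%E); last first.
  by apply: ge0_subset_integral.
apply: (@le_trans _ _ (\int[nu]_(y in A) (a ^+ 2)%:E)%E).
  rewrite integral_cst//.
  apply: (@le_trans _ _ ((a ^+ 2)%:E * p%:E)%E); first by rewrite -EFinM lee_fin.
  by apply: lee_wpmul2l => //; rewrite lee_fin sqr_ge0.
apply: ge0_le_integral => //.
- by move=> y _; rewrite lee_fin sqr_ge0.
- exact: measurable_funTS.
- move=> y Ay; rewrite lee_fin -[leRHS]real_normK ?num_real//.
  by rewrite ler_sqr ?nnegrE// af.
Qed.

(** Dominated convergence in [L^2]. *)
Lemma Lnorm2_cvg0 (f : nat -> Y -> R) g :
  (forall n, measurable_fun setT (f n)) -> measurable_fun setT g ->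
  (Lnorm nu 2%:E (fun y => (g y)%:E) < +oo)%E ->
  (forall n y, `|f n y| <= `|g y|) ->
  (forall y, f n y @[n --> \oo] --> 0) ->
  Lnorm nu 2%:E (fun y => (f n y)%:E) @[n --> \oo] --> 0%E.
Proof.
move=> mf mg goo fg f0.
have m2 h : measurable_fun setT h -> measurable_fun setT (fun y => (h y ^+ 2)%:E).
  by move=> mh; apply/measurable_EFinP; exact: measurable_funX.
have ig : nu.-integrable setT (fun y => (g y ^+ 2)%:E).
  by apply: Lfun2_integrable_sqr; rewrite inE; apply/andP; rewrite !inE /=; split.
have le2 n y : (f n y) ^+ 2 <= g y ^+ 2.
  by rewrite -[leLHS]real_normK ?num_real// -[leRHS]real_normK ?num_real// ler_sqr ?nnegrE.
have If n : (\int[nu]_y (f n y ^+ 2)%:E)%E \is a fin_num.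
  apply: integrable_fin_num => //; apply: le_integrable ig => //; first exact: m2.
  by move=> y _; rewrite /= !ger0_norm ?sqr_ge0// lee_fin.
have : (\int[nu]_y (f n y ^+ 2)%:E)%E @[n --> \oo] --> (\int[nu]_y 0)%E.
  apply: (@dominated_cvg _ _ _ _ _ _ _ _ (fun y => (g y ^+ 2)%:E)) => //.
  - by move=> n; exact: m2.
  - move=> y _; apply: cvg_EFin; first exact: nearW.
    rewrite (_ : _ \o _ = (fun n => f n y * f n y)); last exact/funext.
    by rewrite -(mulr0 0); apply: cvgM; exact: f0.
  - by move=> n y _; rewrite gee0_abs lee_fin ?sqr_ge0.
rewrite integral0 => /fine_cvgP[_ I0].
rewrite (_ : (fun n => _) =
    (fun n => (Num.sqrt (fine (\int[nu]_y (f n y ^+ 2)%:E)%E))%:E)).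
  apply: cvg_EFin; first exact: nearW.
  by rewrite -sqrtr0; apply: continuous_cvg I0; exact: sqrt_continuous.
apply/funext => n; rewrite Lnorm2E -{1}(fineK (If n)) poweR_EFin powR12_sqrt//.
by apply/fine_ge0/integral_ge0 => y _; rewrite lee_fin sqr_ge0.
Qed.

End L2norm.

(** * The cocycle *)

Section Ziter.
Context {T : Type} (f g : T -> T) (fK : cancel f g) (gK : cancel g f).

Lemma ziterS (m : int) x : ziter f g (1 + m) x = f (ziter f g m x).
Proof.
case: m => [n|[|n]] //=.
by rewrite subn1 /= gK.
Qed.

Lemma ziterP (m : int) x : ziter f g (m - 1) x = g (ziter f g m x).
Proof. by rewrite -[m in RHS](subrK 1) [_ - 1 + 1]addrC ziterS fK. Qed.

Lemma ziterD (n m : int) x : ziter f g (n + m) x = ziter f g n (ziter f g m x).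
Proof.
elim/int_rect: n => [|n IH|n IH]; first by rewrite add0r.
  by rewrite intS -addrA !ziterS IH.
by rewrite intS opprD [-1 - _]addrC -addrA [-1 + _]addrC addrA !ziterP IH.
Qed.
End Ziter.

Section Cocycle.
Context (R : realType).
Implicit Types (x y : dyadic) (n : int) (k : nat).

Local Notation "n '+>' x" := (ziter dsucc dpred n x) (at level 30).

(** The increase of the height of index [k] along [n] steps of the orbit of
    [x]; it is the logarithm of the cocycle. *)
Definition excess n x k : R := (height k (n +> x))%:R - (height k x)%:R.

Lemma excess_1 x k : `|excess 1 x k| = 1.
Proof.
rewrite /excess /=; case: (height_succ k x) => ->.
  by rewrite -natr1 addrAC subrr add0r normr1.
by rewrite -natr1 opprD addrA subrr add0r normrN1.
Qed.

Lemma excessD (n m : int) x k : excess (n + m) x k = excess n (m +> x) k + excess m x k.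
Proof.
rewrite /excess (ziterD _ _ dsuccK dpredK).
by rewrite addrA subrK.
Qed.

Lemma excess_N1 x k : `|excess (-1) x k| = 1.
Proof.
have := excessD 1 (-1) x k; rewrite subrr {1}/excess subrr => /esym/eqP.
by rewrite addrC addr_eq0 => /eqP ->; rewrite normrN excess_1.
Qed.

Lemma excess_le_time n x k : `|excess n x k| <= (absz n)%:R.
Proof.
elim/int_rect: n => [|n IH|n IH]; first by rewrite /excess subrr normr0.
  rewrite intS excessD (le_trans (ler_normD _ _))// excess_1.
  by rewrite -intS (natrD _ 1 n) lerD2l.
rewrite [in excess _](_ : - n.+1%:Z = -1 - n%:Z); last by rewrite intS opprD.
rewrite excessD (le_trans (ler_normD _ _))// excess_N1.
by rewrite abszN (natrD _ 1 n) lerD2l; rewrite abszN in IH.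
Qed.

Lemma excess_le_scale n x k : `|excess n x k| <= (2 ^ (k %/ 4).+2)%:R.
Proof.
rewrite /excess; have h y : (height k y)%:R <= (2 ^ (k %/ 4).+2)%:R :> R.
  by rewrite ler_nat height_le.
rewrite ler_norml; have := h x; have := h (n +> x).
have := ler0n R (height k x); have := ler0n R (height k (n +> x)); lra.
Qed.

Lemma excess_grow x (n m : nat) : (n <= 2 ^ m)%N ->
  exists2 k, (k < 4 * m.+1)%N & excess n%:Z x k = n%:R.
Proof.
move=> /height_grow-/(_ x)[k km kn]; exists k => //.
by rewrite /excess /= kn natrD addrAC subrr add0r.
Qed.

Lemma excess_residue n x y k : residue (k %/ 4).+2 x = residue (k %/ 4).+2 y ->
  excess n x k = excess n y k.
Proof.
move=> xy; rewrite /excess (height_residue k x y)//.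
by rewrite (height_residue k (n +> x) (n +> y))//; exact: residue_ziter_eq.
Qed.

(** The cocycle, a coboundary of [exp \o height k]. *)
Definition coc n x k : R[i] := (expR (excess n x k))%:C%C.

Lemma normc_real (r : R) : normc (r%:C)%C = `|r|.
Proof. by rewrite /= expr0n addr0 sqrtr_sqr. Qed.

Lemma normc_ge0 (z : R[i]) : 0 <= normc z.
Proof. by case: z => a b; exact: sqrtr_ge0. Qed.

Lemma normc_coc n x k : normc (coc n x k) = expR (excess n x k).
Proof. by rewrite normc_real ger0_norm ?expR_ge0. Qed.

Lemma logabs_coc n x : logabs (coc n x) = excess n x.
Proof. by apply/funext => k; rewrite /logabs normc_coc expRK. Qed.

Lemma coc_neq0 n x k : coc n x k != 0.
Proof.
apply/eqP => /(congr1 (@complex.Re R)) /= e0.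
by have := expR_gt0 (excess n x k); rewrite e0 ltxx.
Qed.

Lemma cocV n x k : (coc n x k)^-1 = (expR (- excess n x k))%:C%C.
Proof. by rewrite expRN /coc rmorphV ?unitfE ?gt_eqF ?expR_gt0. Qed.

Lemma cocD n m x k : coc (n + m) x k = coc n (m +> x) k * coc m x k.
Proof. by rewrite /coc excessD expRD rmorphM. Qed.

Local Notation nu := (geom R).

Lemma measurable_nat d' (Z : measurableType d') (f : nat -> Z) :
  measurable_fun setT f.
Proof. by []. Qed.

Lemma cmeasurable_nat (phi : nat -> R[i]) : cmeasurable phi.
Proof. by split; exact: measurable_nat. Qed.

Lemma nat_cLnormy_le (phi : nat -> R[i]) (C : R) :
  (forall k, normc (phi k) <= C) -> (cLnorm nu +oo phi <= C%:E)%E.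
Proof.
move=> phiC; have C0 : 0 <= C by rewrite (le_trans _ (phiC 0%N))// normc_ge0.
rewrite /cLnorm unlock; case: ifPn => // _; apply/ess_supP/aeW => k /=.
by rewrite lee_fin ger0_norm ?normc_ge0.
Qed.

Lemma nat_cLfuny (phi : nat -> R[i]) (C : R) :
  (forall k, normc (phi k) <= C) -> cLfun nu +oo phi.
Proof.
move=> phiC; split; first exact: cmeasurable_nat.
exact: le_lt_trans (nat_cLnormy_le phi C phiC) (ltry _).
Qed.

Lemma nat_Lfun2 (h : nat -> R) (C : R) : (forall k, `|h k| <= C) ->
  h \in Lfun nu 2%:E.
Proof.
move=> hC; rewrite inE; apply/andP; rewrite !inE /=; split=> //.
exact: le_lt_trans (Lnorm2_le nu h C (measurable_nat _ _ h) hC) (ltry _).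
Qed.

Lemma Mx_coc n x : Mx nu (coc n x).
Proof.
split.
- apply: (nat_cLfuny _ (expR (absz n)%:R)) => k; rewrite normc_coc ler_expR.
  exact: le_trans (ler_norm _) (excess_le_time n x k).
- by apply: aeW => k; apply/eqP; exact: coc_neq0.
- apply: (nat_cLfuny _ (expR (absz n)%:R)) => k.
  rewrite cocV normc_real ger0_norm ?expR_ge0// ler_expR.
  by rewrite (le_trans (ler_norm _))// normrN excess_le_time.
Qed.

Lemma GL2_coc n x : GL2 nu (coc n x).
Proof.
split; first exact: cmeasurable_nat.
- by apply: aeW => k; apply/eqP; exact: coc_neq0.
- by rewrite logabs_coc; apply: nat_Lfun2; exact: excess_le_time.
Qed.

Lemma coc_cocycle : cocycle nu (haar R) dsucc dpred coc.
Proof. by move=> n m; apply: aeW => x; apply: aeW => k; exact: cocD. Qed.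

Lemma Lnorm_log_coc1 x : Lnorm nu 2%:E (fun k => (logabs (coc 1 x) k)%:E) = 1%E.
Proof.
rewrite logabs_coc -Lnorm_abse -(Lnorm2_cst nu 1 ler01).
by apply: eq_Lnorm => k /=; rewrite excess_1.
Qed.

Lemma cLnormy_coc1_le x : (cLnorm nu +oo (coc 1 x) <= (expR 1)%:E)%E.
Proof.
apply: nat_cLnormy_le => k; rewrite normc_coc ler_expR -(excess_1 x k).
exact: ler_norm.
Qed.

Lemma inv_natr_cvg0 : (n%:R^-1 : R) @[n --> \oo] --> (0 : R).
Proof. by rewrite -(cvg_shiftS (fun n : nat => n%:R^-1 : R)); exact: cvg_harmonic. Qed.

Lemma excess_div_le1 (n : nat) x k : `|n%:R^-1 * excess n%:Z x k| <= 1.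
Proof.
rewrite normrM normfV normr_nat; have [->|n0] := eqVneq n 0%N.
  by rewrite invr0 mul0r.
by rewrite ler_pdivrMl ?mulr1 ?ltr0n ?lt0n//; exact: excess_le_time.
Qed.

Lemma excess_div_cvg0 x k : (n%:R^-1 * excess n%:Z x k) @[n --> \oo] --> 0.
Proof.
pose C : R := (2 ^ (k %/ 4).+2)%:R.
apply/norm_cvg0P; apply: (@squeeze_cvgr _ _ _ _ (fun=> 0) (fun n : nat => n%:R^-1 * C)).
- apply: nearW => n; rewrite normr_ge0 normrM normfV normr_nat /=.
  by rewrite ler_wpM2l ?invr_ge0//; exact: excess_le_scale.
- exact: cvg_cst.
- by rewrite -(mul0r C); apply: cvgM; [exact: inv_natr_cvg0|exact: cvg_cst].
Qed.

Lemma coc_limit_operator x : limit_operator nu (fun n : nat => coc n%:Z x) (fun=> 1).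
Proof.
split=> //.
- exact: aeW.
- by rewrite ln1; exact: Lfun_cst.
under eq_fun do under eq_fun do rewrite logabs_coc ln1 subr0.
apply: (@Lnorm2_cvg0 _ _ _ nu (fun (n : nat) k => n%:R^-1 * excess n%:Z x k) (fun=> 1)).
- by [].
- by [].
- by rewrite Lnorm2_cst// ltry.
- by move=> n k; rewrite normr1 excess_div_le1.
- exact: excess_div_cvg0.
Qed.

(** At every time [n > 0] some index [k] has [excess n x k = n], so the
    supremum norm of the average is at least [1]. *)
Lemma coc_log_sup x :
  ~ (Lnorm nu +oo%E (fun k => (n%:R^-1 * logabs (coc n%:Z x) k - ln (1 : R))%:E)
      @[n --> \oo] --> 0%E).
Proof.
move=> /fine_cvgP[fin /cvgr0Pnorm_lt/(_ _ ltr01) small].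
have [n [n0 [fn sn]]] := filter_ex (filterI (nbhs_infty_gt 0) (filterI fin small)).
have [k _ kn] := excess_grow x n n (ltnW (ltn_expl n (ltnSn 1))).
move: sn; apply/negP; rewrite -leNgt (le_trans _ (ler_norm _))//.
rewrite -lee_fin fineK// unlock ifT; last by rewrite [X in (0 < X)%E](_ : _ = 1%E) ?lte01//; exact: (probability_setT nu).
have /geom_ae/(_ k) := @ess_sup_ge _ _ _ nu
  (abse \o (fun k => (n%:R^-1 * logabs (coc n%:Z x) k - ln (1 : R))%:E)).
apply: le_trans; rewrite /= lee_fin logabs_coc kn ln1 subr0 mulVf ?pnatr_eq0 -?lt0n//.
by rewrite normr1.
Qed.

Lemma sqr_le_expn2 j : ((j + 2) ^ 2 <= 16 * 2 ^ j)%N.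
Proof.
elim: j => // -[//|j] IH; rewrite expnS.
have : ((j.+2 + 2) ^ 2 <= 2 * (j.+1 + 2) ^ 2)%N by rewrite !expnS !expn0; nia.
by move/leq_trans; apply; rewrite (mulnCA 16) leq_mul2l.
Qed.

Lemma trunc_log_div_le (n : nat) : (0 < n)%N ->
  (trunc_log 2 n + 2)%:R / n%:R <= 4 * Num.sqrt (n%:R^-1) :> R.
Proof.
move=> n0; have n0' : 0 < n%:R :> R by rewrite ltr0n.
rewrite -ler_sqr ?nnegrE ?divr_ge0 ?mulr_ge0 ?sqrtr_ge0//.
rewrite exprMn exprVn [leRHS]exprMn sqr_sqrtr ?invr_ge0//.
rewrite ler_pdivrMr ?exprn_gt0// -natrX.
have -> : 4 ^+ 2 / n%:R * n%:R ^+ 2 = (16 * n)%:R :> R.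
  by rewrite natrM; field; rewrite gt_eqF.
rewrite ler_nat; apply: leq_trans (sqr_le_expn2 _) _.
by rewrite leq_mul2l /=; exact: trunc_logP.
Qed.

(** The index provided by [excess_grow] at scale [trunc_log 2 n + 1] has mass at
    least [2 ^- (4 * (trunc_log 2 n + 2))], with square root
    [expR (- (ln 4 * (trunc_log 2 n + 2)%:R))]. *)
Lemma coc_norm_ge (n : nat) x :
  ((expR (n%:R - ln 4 * (trunc_log 2 n + 2)%:R))%:E <=
    cLnorm nu 2%:E (coc n%:Z x))%E.
Proof.
have [|k km kn] := excess_grow x n (trunc_log 2 n).+1.
  exact/ltnW/trunc_log_ltn.
rewrite /cLnorm; under eq_fun do rewrite normc_coc.
apply: (@Lnorm2_ge _ _ _ nu _ [set k] (expR n%:R) _ (2 ^- k.+1)) => //.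
- exact: geom_set1.
- by move=> _ ->; rewrite kn ger0_norm ?expR_ge0.
rewrite expRD exprMn ler_wpM2l ?sqr_ge0// expRN expRM lnK ?posrE//.
rewrite powR_mulrn// (_ : 4 = 2 ^+ 2); last by rewrite expr2 -natrM.
rewrite exprVn -!exprM lef_pV2 ?posrE ?exprn_gt0// ler_eXn2l ?ltr1n//.
lia.
Qed.

Lemma coc_norm_le (n : nat) x : (cLnorm nu 2%:E (coc n%:Z x) <= (expR n%:R)%:E)%E.
Proof.
apply: Lnorm2_le => // k; rewrite normc_coc ger0_norm ?expR_ge0// ler_expR.
exact: le_trans (ler_norm _) (excess_le_time n x k).
Qed.

Lemma coc_growth x :
  ((cLnorm nu 2%:E (coc n%:Z x)) `^ n%:R^-1)%E @[n --> \oo] --> (expR 1)%:E.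
Proof.
pose low (n : nat) : R := expR (1 - ln 4 * (4 * Num.sqrt n%:R^-1)).
apply: (@squeeze_cvge _ _ _ _ (fun n : nat => (low n)%:E) _ (fun=> (expR 1)%:E)).
- near=> n; have n0 : (0 < n)%N by near: n; exact: nbhs_infty_gt.
  have n0' : 0 < n%:R :> R by rewrite ltr0n.
  have powE (a : R) : ((expR a)%:E `^ n%:R^-1)%E = (expR (a / n%:R))%:E.
    by rewrite poweR_EFin -expRM.
  apply/andP; split.
    apply: (@le_trans _ _
        ((expR (n%:R - ln 4 * (trunc_log 2 n + 2)%:R))%:E `^ n%:R^-1)%E).
      rewrite powE lee_fin ler_expR mulrBl divff ?gt_eqF// -mulrA.
      by rewrite lerD2l lerN2 ler_wpM2l ?ln_ge0 ?ler1n// trunc_log_div_le.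
    by apply: gt0_ler_poweR; rewrite ?in_itv /= ?leey ?Lnorm_ge0 ?invr_ge0
       ?lee_fin ?expR_ge0//; exact: coc_norm_ge.
  apply: (@le_trans _ _ ((expR n%:R)%:E `^ n%:R^-1)%E).
    by apply: gt0_ler_poweR; rewrite ?in_itv /= ?leey ?Lnorm_ge0 ?invr_ge0
       ?lee_fin ?expR_ge0//; exact: coc_norm_le.
  by rewrite powE divff ?gt_eqF.
- apply: cvg_EFin; first exact: nearW.
  rewrite [X in expR X](_ : 1 = 1 - ln 4 * (4 * Num.sqrt 0) :> R); last first.
    by rewrite sqrtr0 !mulr0 subr0.
  apply: continuous_cvg; first exact: continuous_expR.
  apply: cvgB; first exact: cvg_cst.
  apply: cvgM; first exact: cvg_cst.
  apply: cvgM; first exact: cvg_cst.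
  by apply: continuous_cvg inv_natr_cvg0; exact: sqrt_continuous.
- exact: cvg_cst.
Unshelve. all: by end_near. Qed.

Lemma coc_sot_open (n : int) (U : set (nat -> R[i])) :
  sot_open nu U -> open (coc n @^-1` U : set dyadic).
Proof.
move=> [_ Uopen]; rewrite openE => x /= /Uopen[p [v [e [vL2 e0 vU]]]].
pose B : R := expR (absz n)%:R + expR (absz n)%:R.
have B0 : 0 <= B by rewrite addr_ge0// expR_ge0.
(* A bound for [(c n y k - c n x k) * v i k] when [x] and [y] are congruent
   modulo [2 ^ M]: the first factor vanishes for small [k], and [B] bounds it
   for the other ones. *)
pose tail i (M k : nat) : R := (M <= (k %/ 4).+2)%:R * (normc (v i k) * B).
have tail0 i : \forall M \near \oo,
    (Lnorm nu 2%:E (fun k => (tail i M k)%:E) < e%:E)%E.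
  have Bv : (Lnorm nu 2%:E (fun k => (normc (v i k) * B)%:E) < +oo)%E.
    have [_ vi] := vL2 i.
    have vL : (fun k => normc (v i k)) \in Lfun nu 2%:E.
      by rewrite inE; apply/andP; rewrite !inE.
    have := Lfun_scale B (ler1n R 2) vL.
    by rewrite inE => /andP[_]; rewrite inE.
  have : Lnorm nu 2%:E (fun k => (tail i M k)%:E) @[M --> \oo] --> 0%E.
    apply: (@Lnorm2_cvg0 _ _ _ nu _ (fun k => normc (v i k) * B)) => //.
    - move=> M k; rewrite /tail normrM ler_piMl// normr_nat lern1.
      exact: leq_b1.
    - move=> k; apply/cvgrPdist_lt => d d0; near=> M.
      rewrite /tail leqNgt (_ : (_ < M)%N) ?mul0r ?subrr ?normr0//.
      by near: M; exact: nbhs_infty_gt.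
  move=> /fine_cvgP[fin /cvgr0Pnorm_lt/(_ _ e0) small].
  apply: filterS2 fin small => M fM sM.
  by rewrite -(fineK fM) lte_fin (le_lt_trans (ler_norm _)).
have [M Mtail] := filter_ex (filter_forall _ tail0).
apply/dyadic_nbhsP; exists M => y xy; apply: vU.
  by have [] := Mx_coc n y.
move=> i; apply: le_lt_trans (Mtail i).
apply: le_Lnorm2 => // k.
rewrite ger0_norm ?normc_ge0// Normc.normcM /tail.
rewrite /coc -rmorphB normc_real.
have [Mk|kM] := leqP M (k %/ 4).+2.
  rewrite mul1r [leRHS]ger0_norm ?mulr_ge0 ?normc_ge0// mulrC.
  rewrite ler_wpM2l ?normc_ge0// (le_trans (ler_normB _ _))//.
  rewrite !ger0_norm ?expR_ge0// lerD// ler_expR;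
    exact: le_trans (ler_norm _) (excess_le_time n _ k).
rewrite (excess_residue n x y k) ?subrr ?normr0 ?mul0r//.
exact: residue_le_eq (ltnW kM) xy.
Unshelve. all: by end_near. Qed.

Lemma coc_sot_measurable (n : int) :
  sot_measurable nu (coc n : dyadicm -> nat -> R[i]).
Proof.
move=> B; pose G := [set B : set (nat -> R[i]) |
  measurable (coc n @^-1` B : set dyadicm)].
have : <<s sot_open nu >> `<=` G.
  apply: smallest_sub.
    split; rewrite /G /=.
    - by rewrite preimage_set0.
    - by move=> A mA; rewrite setTD preimage_setC; exact: measurableC.
    - by move=> F mF; rewrite preimage_bigcup; exact: bigcupT_measurable.
  by move=> U /(coc_sot_open n); exact: open_dyadic_measurable.
exact.
Qed.

End Cocycle.

Theorem theorem2p4 (R : realType) :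
  exists (dX dY : measure_display)
    (X : measurableType dX) (Y : measurableType dY)
    (mu : probability X R) (nu : probability Y R)
    (f g : X -> X) (c : int -> X -> Y -> R[i])
    (xi : Y -> R[i]) (Lambda : X -> Y -> R),
    (standard_borel R X /\ standard_borel R Y) /\
    (pmp_invertible mu f g /\ ergodic mu f) /\
    (forall n x, Mx nu (c n x) /\ GL2 nu (c n x)) /\
    cocycle nu mu f g c /\
    (forall n, sot_measurable nu (c n)) /\
    mu.-integrable setT
      (fun x => Lnorm nu 2%:E (fun y => (logabs (c 1 x) y)%:E)) /\
    cLfun nu 2%:E xi /\
    {ae mu, forall x, limit_operator nu (fun n => c n%:Z x) (Lambda x)} /\
    {ae mu, forall x, exists a b : R,
      [/\ (cLnorm nu 2%:E (fun y => c n%:Z x y * xi y)%R `^ n%:R^-1)%E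
            @[n --> \oo] --> a%:E,
          (cLnorm nu 2%:E (c n%:Z x) `^ n%:R^-1)%E @[n --> \oo] --> a%:E,
          b < a,
          (cLnorm nu 2%:E (fun y => (Lambda x y ^+ n)%:C%C * xi y)%R
             `^ n%:R^-1)%E @[n --> \oo] --> b%:E &
          (cLnorm nu 2%:E (fun y => (Lambda x y ^+ n)%:C%C)%R
             `^ n%:R^-1)%E @[n --> \oo] --> b%:E]} /\
    (exists C : R, {ae mu, forall x, (cLnorm nu +oo (c 1%R x) <= C%:E)%E}) /\
    {ae mu, forall x,
      ~ (Lnorm nu +oo%E (fun y =>
             (n%:R^-1 * logabs (c n%:Z x) y - ln (Lambda x y))%:E)
           @[n --> \oo] --> 0%E)}.
Proof.
have one_norm : cLnorm (geom R) 2%:E (fun=> 1) = 1%E.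
  rewrite /cLnorm; under eq_fun do rewrite Normc.normc1.
  by rewrite Lnorm2_cst.
exists _, _, dyadicm, nat, (haar R), (geom R), dsucc, dpred, (coc R),
  (fun=> 1), (fun _ _ => 1).
split; first by split; [exact: dyadic_standard_borel|exact: nat_standard_borel].
split; first by split; [exact: dsucc_pmp|exact: dsucc_ergodic].
split; first by move=> n x; split; [exact: Mx_coc|exact: GL2_coc].
split; first exact: coc_cocycle.
split; first exact: coc_sot_measurable.
split.
  under eq_fun do rewrite Lnorm_log_coc1.
  exact: finite_measure_integrable_cst.
split; first by split; [exact: cmeasurable_nat|rewrite one_norm ltry].
split; first by apply: aeW => x; exact: coc_limit_operator.
split.
  apply: aeW => x; exists (expR 1), 1; split.
  - by under eq_fun do under eq_fun do rewrite mulr1; exact: coc_growth.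
  - exact: coc_growth.
  - by rewrite -expR0 ltr_expR.
  - rewrite (_ : (fun _ => _) = fun=> 1%E); first exact: cvg_cst.
    apply/funext => n; under eq_fun do rewrite expr1n mulr1.
    by rewrite one_norm poweR_EFin powR1.
  - rewrite (_ : (fun _ => _) = fun=> 1%E); first exact: cvg_cst.
    apply/funext => n; under eq_fun do rewrite expr1n.
    by rewrite one_norm poweR_EFin powR1.
split; first by exists (expR 1); apply: aeW => x; exact: cLnormy_coc1_le.
by apply: aeW => x; exact: coc_log_sup.
Qed.
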